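(* The problem (2-SPNI) is intractable, even on two-terminal series-parallel graphs and even with unit interdiction costs ($c(a)=1$ for all $a\in A$): there exist instances for which the number of non-dominated points is exponential in the size of the instance.
   Context: An instance $(G,l,c,B)$ of (2-SPNI) consists of a directed network (multiple parallel arcs allowed) $G=(V,A)$ with source $s$ and sink $t$, lengths $l=(l^1,l^2):A\to\mathbb{N}^2$, interdiction costs $c:A\to\mathbb{N}$ and budget $B\in\mathbb{N}$. Feasible strategies: $\Gamma=\{\gamma\in\{0,1\}^A:\sum_a c(a)\gamma_a\leq B\}$; $G(\gamma)$ is $G$ with the arcs $a$ having $\gamma_a=1$ removed. For $\gamma\in\Gamma$, $f_G(\gamma)=(f^1_G(\gamma),f^2_G(\gamma))$ where $f^i_G(\gamma)$ is the minimum of $l^i(P)=\sum_{a\in P}l^i(a)$ over all $s$-$t$-paths $P$ in $G(\gamma)$ ($\infty$ if none). The Pareto order: $y_1\geq y_2$ iff $y_1^k\geq y_2^k$ for $k=1,2$ and $y_1\neq y_2$. A strategy $\gamma\in\Gamma$ is efficient if no $\gamma'\in\Gamma$ has $f_G(\gamma')\geq f_G(\gamma)$; then $f_G(\gamma)$ is a non-dominated point. A directed graph is two-terminal series-parallel with source $s$ and sink $t$ if it can be built from single-arc graphs $(s,t)$ by repeated parallel compositions (identifying sources and identifying sinks of two such graphs) and series compositions (identifying the sink of the first with the source of the second). *)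

(* Defs.v *)
From mathcomp Require Import all_boot all_order all_algebra.
From mathcomp Require Import constructive_ereal.

Set Implicit Arguments.
Unset Strict Implicit.
Unset Printing Implicit Defensive.

Import Order.TTheory.

(* Arcs are objects of their own, so parallel arcs are allowed. *)
Record network := Network {
  vertices : finType;
  arcs : finType;
  src : arcs -> vertices;
  tgt : arcs -> vertices;
  source : vertices;
  sink : vertices }.

(* [glued R i1 i2 j]: via the vertex maps i1, i2 and the arc bijection j, the
   digraph of G is the disjoint union of those of G1 and G2 in which a vertex
   x of G1 and a vertex y of G2 are identified exactly when R x y. *)
Record glued (G1 G2 G : network) (R : vertices G1 -> vertices G2 -> bool)
    (i1 : vertices G1 -> vertices G) (i2 : vertices G2 -> vertices G)
    (j : arcs G1 + arcs G2 -> arcs G) : Prop := Glued {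
  glued_inj1 : injective i1;
  glued_inj2 : injective i2;
  glued_ident : forall x y, (i1 x == i2 y) = R x y;
  glued_surj : forall v, (exists x, v = i1 x) \/ (exists y, v = i2 y);
  glued_arcs : bijective j;
  glued_src1 : forall a, src (j (inl a)) = i1 (src a);
  glued_tgt1 : forall a, tgt (j (inl a)) = i1 (tgt a);
  glued_src2 : forall a, src (j (inr a)) = i2 (src a);
  glued_tgt2 : forall a, tgt (j (inr a)) = i2 (tgt a) }.

Definition single_arc (G : network) : Prop :=
  [/\ #|vertices G| = 2, #|arcs G| = 1, source G != sink G
    & forall a : arcs G, src a = source G /\ tgt a = sink G].

Definition parallel_composition (G1 G2 G : network) : Prop :=
  exists i1 i2 j,
    [/\ @glued G1 G2 G (fun x y => (x == source G1) && (y == source G2)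
                                || (x == sink G1) && (y == sink G2)) i1 i2 j,
        source G = i1 (source G1) & sink G = i1 (sink G1)].

Definition series_composition (G1 G2 G : network) : Prop :=
  exists i1 i2 j,
    [/\ @glued G1 G2 G (fun x y => (x == sink G1) && (y == source G2)) i1 i2 j,
        source G = i1 (source G1) & sink G = i2 (sink G2)].

Inductive series_parallel : network -> Prop :=
| SP_arc G : single_arc G -> series_parallel G
| SP_parallel G1 G2 G : series_parallel G1 -> series_parallel G2 ->
    parallel_composition G1 G2 G -> series_parallel G
| SP_series G1 G2 G : series_parallel G1 -> series_parallel G2 ->
    series_composition G1 G2 G -> series_parallel G.

Fixpoint walk (G : network) (u : vertices G) (p : seq (arcs G)) (v : vertices G) :=
  if p is a :: p' then (src a == u) && walk (tgt a) p' v else u == v.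

Definition st_path (G : network) (p : seq (arcs G)) : bool :=
  walk (source G) p (sink G) && uniq (source G :: map (@tgt G) p).

Record instance := Instance {
  net :> network;
  len : arcs net -> nat * nat;
  cost : arcs net -> nat;
  budget : nat }.

Definition strategy (I : instance) : finType := {ffun arcs I -> bool}.

Definition feasible (I : instance) (g : strategy I) : bool :=
  \sum_(a : arcs I) cost a * g a <= budget I.

(* Minimum weight of a source-sink path avoiding the arcs removed by g, and +oo
   if there is none. A path visits each vertex at most once, hence has fewer
   than #|vertices I| arcs, so the bound on its number of arcs excludes nothing. *)
Definition shortest (I : instance) (w : arcs I -> nat) (g : strategy I)
  : \bar int :=
  \big[Order.min/+oo%E]_(p : #|vertices I|.-bseq (arcs I)
                         | st_path p && all (fun a => ~~ g a) p)
    ((\sum_(a <- p) w a)%N%:Z)%:E.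

Definition objective (I : instance) (g : strategy I) : \bar int * \bar int :=
  (shortest (fun a => (len a).1) g, shortest (fun a => (len a).2) g).

(* The interdictor maximizes: y dominates y' when y >= y' in the Pareto order. *)
Definition dominates (y y' : \bar int * \bar int) : bool :=
  [&& (y'.1 <= y.1)%O, (y'.2 <= y.2)%O & y != y'].

Definition efficient (I : instance) (g : strategy I) : bool :=
  feasible g &&
  [forall g' : strategy I, feasible g' ==> ~~ dominates (objective g') (objective g)].

Definition non_dominated_points (I : instance) : seq (\bar int * \bar int) :=
  undup [seq objective g | g <- enum (strategy I) & efficient g].

Definition bits (n : nat) : nat := (trunc_log 2 n).+1.

(* Binary encoding length: the vertices, then for each arc its two end points,
   its two lengths and its cost, then source, sink and budget. *)
Definition instance_size (I : instance) : nat :=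
  #|vertices I|
  + \sum_(a : arcs I) (2 * bits #|vertices I|
                      + bits (len a).1 + bits (len a).2 + bits (cost a))
  + 2 * bits #|vertices I| + bits (budget I).

(* On the class C the number of non-dominated points is exponential in the
   instance size: for some k there are arbitrarily large instances with at least
   2 ^ (size ^ (1/k)) non-dominated points (m plays the role of an upper bound
   on size ^ (1/k)). The root cannot be dropped: with lengths in binary, an
   instance of size L has only 2 ^ O(sqrt L) non-dominated points. *)
Definition intractable_on (C : instance -> Prop) : Prop :=
  exists k : nat, forall N : nat, exists (I : instance) (m : nat),
    [/\ C I, N <= instance_size I, instance_size I <= m ^ k
      & 2 ^ m <= size (non_dominated_points I)].

(* Main.v *)
(* Put 2n stages in series. In stage i a single arc of length (0, 0) is parallel
   to n + 1 arcs of length (2 ^ i, 4 ^ n - 2 ^ i), and the budget is n, so no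
   stage can be disconnected. Cutting the free arcs of a set T of stages yields
   an objective with coordinate sum #|T| * 4 ^ n; hence for #|T| = n the
   strategy attains the maximal sum, and is efficient. By uniqueness of binary
   expansions distinct sets T yield distinct points, and there are
   'C(2n, n) >= 2 ^ n sets of size n. *)
Require Import Defs.
From mathcomp Require Import all_boot all_order all_algebra.
From mathcomp Require Import constructive_ereal zify.

Set Implicit Arguments.
Unset Strict Implicit.
Unset Printing Implicit Defensive.

Import Order.TTheory.

(* [r] parallel arcs from vertex i to vertex i + 1, for each i < N. *)
Definition chain (N r : nat) : network :=
  @Network 'I_N.+1 ('I_N * 'I_r)%type
    (fun a => widen_ord (leqnSn N) a.1) (fun a => lift ord0 a.1) ord0 ord_max.

(** * Chains as series-parallel graphs *)

Lemma bundle_series_parallel (r : nat) : series_parallel (chain 1 r.+1).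
Proof.
have bundle1 : series_parallel (chain 1 1).
  apply: SP_arc; split=> //=; first by rewrite card_ord.
    by rewrite card_prod !card_ord.
  by move=> [a c] /=; split; apply: val_inj; rewrite /= ?ord1.
elim: r => [//|r IHr].
apply: (SP_parallel IHr bundle1).
(* Both bundles have the same two vertices; the added arc gets the last index. *)
exists id, id, (fun s => match s with
  | inl (i, c) => (i, widen_ord (leqnSn r.+1) c)
  | inr (i, _) => (i, ord_max) end).
split=> //; split=> //=.
- by case=> [[|[|//]] ?] [[|[|//]] ?].
- by move=> v; left; exists v.
- apply: inj_card_bij; last by rewrite card_sum !card_prod !card_ord; lia.
  move=> [[i c]|[i c]] [[i' c']|[i' c']] //= [].
  + by move=> -> /ord_inj ->.
  + by move=> _ E; have := ltn_ord c; rewrite E ltnn.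
  + by move=> _ E; have := ltn_ord c'; rewrite -E ltnn.
  + by move=> ->; rewrite (ord1 c) (ord1 c').
- by case.
- by case.
- by case.
- by case.
Qed.

Lemma chain_series_parallel (N r : nat) : series_parallel (chain N.+1 r.+1).
Proof.
elim: N => [|N IHN]; first exact: bundle_series_parallel.
apply: (SP_series IHN (bundle_series_parallel r)).
(* The old chain keeps its numbering; the new bundle occupies the vertices [N.+1] and [N.+2], so its
   source falls on the old sink. *)
exists (widen_ord (leqnSn N.+2)), (fun x : 'I_2 => inord (N.+1 + x)),
  (fun s => match s with
  | inl (i, c) => (widen_ord (leqnSn N.+1) i, c)
  | inr (_, c) => (ord_max, c) end).
have valI2 (x : 'I_2) : val (inord (N.+1 + x) : 'I_N.+3) = N.+1 + x.
  by rewrite /= inordK //; have := ltn_ord x; lia.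
split.
- split.
  + by move=> x y /(congr1 val) /= /ord_inj.
  + by move=> x y /(congr1 val); rewrite !valI2 => E; apply: ord_inj; lia.
  + move=> x y; rewrite -!val_eqE; rewrite !valI2 /=.
    by have := ltn_ord x; lia.
  + move=> v /=; case: (ltnP v N.+2) => Hv.
      by left; exists (Ordinal Hv); apply: val_inj.
    right; exists ord_max; apply: val_inj; rewrite valI2 /=.
    by have := ltn_ord v; lia.
  + apply: inj_card_bij; last by rewrite card_sum !card_prod !card_ord; lia.
    move=> [[i c]|[i c]] [[i' c']|[i' c']] //= [].
    * by move=> /ord_inj -> ->.
    * by move=> E; have := ltn_ord i; rewrite E ltnn.
    * by move=> E; have := ltn_ord i'; rewrite -E ltnn.
    * by move=> ->; rewrite (ord1 i) (ord1 i').
  + by case=> i c; apply: val_inj.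
  + by case=> i c; apply: val_inj.
  + by case=> i c; apply: val_inj; rewrite valI2 (ord1 i) /=; lia.
  + by case=> i c; apply: val_inj; rewrite valI2 (ord1 i) /= /bump /=; lia.
- exact: val_inj.
- by apply: val_inj; rewrite valI2 /=; lia.
Qed.

(** * Paths and shortest lengths in a chain *)

(** Every arc raises the vertex number by one, so no stage can be skipped or repeated. *)
Lemma walk_chain (N r : nat) (p : seq (arcs (chain N r))) (u : 'I_N.+1) :
  @walk (chain N r) u p ord_max -> [seq val a.1 | a <- p] = iota u (N - u).
Proof.
elim: p u => [|[i c] p IHp] u /=.
  by move/eqP=> ->; rewrite /= subnn.
case/andP=> /eqP <- /IHp /= ->.
by rewrite /bump /= add1n -[N - i]prednK ?subn_gt0 // subnS.
Qed.

Lemma chain_walk (N r : nat) (h : 'I_N -> 'I_r) (s : seq 'I_N) (u : 'I_N.+1) :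
  map val s = iota u (N - u) ->
  @walk (chain N r) u [seq (i, h i) | i <- s] ord_max.
Proof.
have leuN : u <= N by rewrite -ltnS.
elim: s u leuN => [|i s IHs] u leuN /=.
  move/(congr1 size); rewrite size_iota /= => E.
  by apply/eqP/val_inj => /=; lia.
move=> E; have ltuN : u < N by rewrite -subn_gt0; case: (N - u) E.
move: E; rewrite -[N - u]prednK ?subn_gt0 //= -subnS => -[Eiu Es].
apply/andP; split; first by apply/eqP/val_inj.
by apply: IHs; rewrite /= /bump /= Eiu.
Qed.

(** A path takes exactly one arc per stage, so the minimum splits into stagewise minima [d i],
    attained at the surviving arcs [h i]. *)
Lemma shortest_chain (N r : nat) (l : arcs (chain N r) -> nat * nat)
    (c : arcs (chain N r) -> nat) (B : nat) (w : arcs (chain N r) -> nat)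
    (g : strategy (@Instance (chain N r) l c B))
    (d : 'I_N -> nat) (h : 'I_N -> 'I_r) :
    (forall i, ~~ g (i, h i)) -> (forall i, w (i, h i) = d i) ->
    (forall a, ~~ g a -> d a.1 <= w a) ->
  @shortest (@Instance (chain N r) l c B) w g = ((\sum_i d i)%N%:Z)%:E.
Proof.
move=> gh wh dw; apply/le_anti/andP; split.
  have size_h : size [seq (i, h i) | i <- enum 'I_N] <= #|'I_N.+1|.
    by rewrite size_map size_enum_ord card_ord.
  apply: (@bigmin_inf _ _ _ _ (Bseq size_h)) => /=; last first.
    by rewrite big_map (eq_bigr d) ?big_enum.
  rewrite all_map; apply/andP; split; last by apply/allP => i _ /=.
  apply/andP; split.
    by apply: chain_walk; rewrite val_enum_ord subn0.
  rewrite -(map_inj_uniq val_inj) /=.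
  (* The arc heads are the vertices 1 to [N]: together with the source 0 they are distinct. *)
  rewrite (_ : map _ (map _ _) = iota 1 N); last first.
    by rewrite (iotaDl 1 0) -val_enum_ord -!map_comp; apply: eq_map.
  by rewrite mem_iota iota_uniq.
apply: le_bigmin => [|p /andP [/andP [/walk_chain Wp _] /allP gp]].
  by rewrite leey.
rewrite lee_fin lez_nat.
have Ep : [seq a.1 | a <- p] = enum 'I_N.
  by apply: (inj_map val_inj); rewrite val_enum_ord -map_comp Wp subn0.
rewrite -big_enum -Ep big_map.
rewrite big_seq_cond [leqRHS]big_seq_cond.
by apply: leq_sum => a /andP [/gp /dw].
Qed.

(** * Binary expansions and the central binomial coefficient *)

(** Parity determines the lowest bit; halving the rest gives the induction. *)
Lemma sum_pow2_inj (N : nat) (b b' : 'I_N -> bool) :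
  \sum_i b i * 2 ^ i = \sum_i b' i * 2 ^ i -> b =1 b'.
Proof.
elim: N b b' => [|N IHN] b b'; first by move=> _ [].
rewrite !big_ord_recl !muln1.
have split2 (e : 'I_N.+1 -> bool) :
    \sum_(i < N) e (lift ord0 i) * 2 ^ (lift ord0 i)
    = 2 * \sum_(i < N) e (lift ord0 i) * 2 ^ i.
  by rewrite big_distrr; apply: eq_bigr => i _ /=; rewrite /bump /= expnS mulnCA.
rewrite !split2 => E.
have E0 : b ord0 = b' ord0 by move: E; case: (b _); case: (b' _); lia.
have /IHN Eb : \sum_i b (lift ord0 i) * 2 ^ i = \sum_i b' (lift ord0 i) * 2 ^ i.
  by move/eqP: E; rewrite E0 eqn_add2l eqn_pmul2l // => /eqP.
move=> i; case: (unliftP ord0 i) => [j ->|-> //].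
exact: Eb.
Qed.

Lemma leq_exp2_central_bin (n : nat) : 2 ^ n <= 'C(n.*2, n).
Proof.
(* Passing from [k] to [k.+1] multiplies the coefficient by (n + k + 1) / (k + 1), which is at least
   2 for k < n. *)
suff le_bin k : k <= n -> 2 ^ k <= 'C(n + k, k) by rewrite -addnn le_bin.
elim: k => [|k IHk] ltkn; first by rewrite bin0.
rewrite -(leq_pmul2l (ltn0Sn k)) addnS -mul_bin_diag expnS.
by rewrite mulnA leq_mul ?IHk ?(ltnW ltkn) //=; lia.
Qed.

(** * The instances and their non-dominated points *)

(** Index [ord0] marks the free arc of a stage. As [a.1] is below [n.*2], the subtraction never
    truncates. *)
Definition split_instance (n : nat) : instance :=
  @Instance (chain n.*2 n.+2)
    (fun a => if a.2 == ord0 then (0, 0) else (2 ^ a.1, 2 ^ n.*2 - 2 ^ a.1))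
    (fun=> 1) n.

Definition cut_stages (n : nat) (g : strategy (split_instance n)) : {set 'I_n.*2} :=
  [set i | g (i, ord0)].

Definition cut_strategy (n : nat) (T : {set 'I_n.*2}) : strategy (split_instance n) :=
  [ffun a => (a.2 == ord0) && (a.1 \in T)].

Lemma cut_strategyK (n : nat) : cancel (@cut_strategy n) (@cut_stages n).
Proof. by move=> T; apply/setP=> i; rewrite inE ffunE eqxx. Qed.

Lemma feasible_sum (n : nat) (g : strategy (split_instance n)) :
  feasible g = (\sum_i \sum_c g (i, c) <= n).
Proof.
rewrite /feasible pair_bigA /=; congr (_ <= _).
by apply: eq_bigr => -[i c] _; rewrite mul1n.
Qed.

Lemma feasible_cut_strategy (n : nat) (T : {set 'I_n.*2}) :
  feasible (cut_strategy T) = (#|T| <= n).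
Proof.
rewrite feasible_sum -sum1_card [in RHS]big_mkcond; congr (_ <= _).
apply: eq_bigr => i _; rewrite big_ord_recl ffunE /= big1 ?addn0; last first.
  by move=> j _; rewrite ffunE.
by case: (i \in T).
Qed.

Lemma card_cut_stages (n : nat) (g : strategy (split_instance n)) :
  feasible g -> #|cut_stages g| <= n.
Proof.
rewrite feasible_sum; apply: leq_trans.
rewrite -sum1_card big_mkcond; apply: leq_sum => i _.
by rewrite inE big_ord_recl; case: (g _).
Qed.

(** The budget cannot remove all [n.+1] costly arcs of a stage, so a stage contributes nothing if
    its free arc survives and the common costly length otherwise. *)
Lemma objective_split (n : nat) (g : strategy (split_instance n)) :
  feasible g ->
  objective g = (((\sum_(i in cut_stages g) 2 ^ i)%N%:Z)%:E,
                 ((\sum_(i in cut_stages g) (2 ^ n.*2 - 2 ^ i))%N%:Z)%:E).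
Proof.
rewrite feasible_sum => feas.
have survivor i : exists c : 'I_n.+1, ~~ g (i, lift ord0 c).
  apply/existsP; apply: contraLR feas => /existsPn all_cut.
  have cut_all : \sum_(c < n.+1) g (i, lift ord0 c) = n.+1.
    rewrite -[RHS](card_ord n.+1) -sum1_card.
    by apply: eq_bigr => c _; rewrite (negbNE (all_cut c)).
  by rewrite -ltnNge (bigD1 i) //= big_ord_recl cut_all; lia.
pose h i := if i \in cut_stages g then lift ord0 (xchoose (survivor i)) else ord0.
have gh i : ~~ g (i, h i).
  rewrite /h; case: ifP => [_|]; first exact: xchooseP (survivor i).
  by rewrite inE => ->.
have cut i c : ~~ g (i, c) -> i \in cut_stages g -> c != ord0.
  by rewrite inE => gic gi0; apply: contraNneq gic => ->.
have shortestE (w : arcs (split_instance n) -> nat) (v : 'I_n.*2 -> nat) :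
    (forall i c, w (i, c) = if c == ord0 then 0 else v i) ->
    shortest w g = ((\sum_(i in cut_stages g) v i)%N%:Z)%:E.
  move=> wE; rewrite big_mkcond; apply: (shortest_chain (h := h)) => //.
    by move=> i; rewrite wE /h; case: (i \in cut_stages g).
  by case=> i c /cut; rewrite wE /=; case: ifP => // _ /(_ isT) /negbTE ->.
rewrite /objective; congr (_, _); apply: shortestE => i c /=; exact: fun_if.
Qed.

Lemma sum_split (N : nat) (T : {set 'I_N}) :
  \sum_(i in T) 2 ^ i + \sum_(i in T) (2 ^ N - 2 ^ i) = #|T| * 2 ^ N.
Proof.
rewrite -big_split -sum_nat_const; apply: eq_bigr => i _ /=.
by rewrite subnKC // leq_exp2l // ltnW.
Qed.

Lemma efficient_cut_strategy (n : nat) (T : {set 'I_n.*2}) :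
  #|T| = n -> efficient (cut_strategy T).
Proof.
move=> cardT; have feasT : feasible (cut_strategy T) by rewrite feasible_cut_strategy cardT.
rewrite /efficient feasT; apply/forallP => g; apply/implyP => feas.
rewrite !objective_split // cut_strategyK; apply/negP.
case/and3P; rewrite /= !lee_fin !lez_nat => le1 le2 /negP; apply.
(* By [sum_split] the coordinate sum of [g] is at most that of [T]; being coordinatewise at least as
   large, the two points then coincide. *)
have : #|cut_stages g| * 2 ^ n.*2 <= #|T| * 2 ^ n.*2.
  by rewrite leq_pmul2r ?expn_gt0 // cardT card_cut_stages.
rewrite -!sum_split; move: le1 le2.
move: (\sum_(i in T) _) (\sum_(i in T) _) => a1 a2.
move: (\sum_(i in _) _) (\sum_(i in _) _) => b1 b2 le1 le2 le_sum.
by have [-> ->] : b1 = a1 /\ b2 = a2 by lia.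
Qed.

Lemma non_dominated_split (n : nat) :
  2 ^ n <= size (non_dominated_points (split_instance n)).
Proof.
apply: leq_trans (leq_exp2_central_bin n) _.
have := card_draws 'I_n.*2 n; rewrite card_ord => <-.
set D := [set _ | _]; rewrite cardE.
rewrite -(size_map (fun T => objective (cut_strategy T))); apply: uniq_leq_size.
  rewrite map_inj_in_uniq ?enum_uniq // => T T'.
  rewrite !mem_enum !inE => /eqP cT /eqP cT'.
  rewrite !objective_split ?feasible_cut_strategy ?cT ?cT' // !cut_strategyK => -[E _].
  (* The first coordinate alone already encodes the set in binary. *)
  apply/setP; apply: sum_pow2_inj.
  move: E; rewrite big_mkcond [in RHS]big_mkcond => E.
  have mkb (S : {set 'I_n.*2}) :
      \sum_i (i \in S) * 2 ^ i = \sum_i (if i \in S then 2 ^ i else 0).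
    by apply: eq_bigr => i _; case: (i \in S); rewrite ?mul1n.
  by rewrite !mkb.
move=> y /mapP [T]; rewrite mem_enum inE => /eqP cT ->.
rewrite mem_undup; apply: map_f.
by rewrite mem_filter efficient_cut_strategy // mem_enum.
Qed.

(** * Encoding length *)

Lemma bits_leq (m k : nat) : m <= 2 ^ k -> bits m <= k.+1.
Proof.
move=> le_m; rewrite /bits ltnS; case: (posnP m) => [-> //|m_gt0].
by rewrite -(leq_exp2l (m := 2)) //; apply: leq_trans (trunc_logP _ m_gt0) le_m.
Qed.

Lemma split_instance_size (n : nat) :
  4 <= n -> instance_size (split_instance n) <= n ^ 6.
Proof.
move=> n4; rewrite /instance_size /= card_ord.
have bitsV : bits n.*2.+1 <= n.*2.+2 by rewrite bits_leq // ltnW // ltn_expl.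
have bitsB : bits n <= n.+1 by rewrite bits_leq // ltnW // ltn_expl.
have bits1 : bits 1 <= 1 by rewrite bits_leq.
set S := \sum_a _.
(* Number of arcs times the bits per arc: two end points, two lengths, unit cost. This is cubic in
   [n], and [4 <= n] lets [n ^ 6] absorb the constants. *)
have : S <= n.*2 * n.+2 * (2 * n.*2.+2 + n.*2.+1 + n.*2.+1 + 1).
  have <- : #|{: 'I_n.*2 * 'I_n.+2}| = n.*2 * n.+2.
    by rewrite card_prod !card_ord.
  rewrite -sum_nat_const; apply: leq_sum => -[i c] _ /=.
  have pow_i : 2 ^ i <= 2 ^ n.*2 by rewrite leq_exp2l // ltnW.
  rewrite !leq_add ?leq_mul //; apply: bits_leq; case: ifP => //= _.
  by rewrite leq_subr.
nia.
Qed.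

Theorem theorem2 :
  intractable_on (fun I : instance =>
    series_parallel I /\ forall a : arcs I, cost a = 1).
Proof.
(* Adding 4 meets the hypothesis of the size bound; the vertices alone make the size at least
   [N]. *)
exists 6 => N; exists (split_instance (N + 4)), (N + 4); split.
- split=> //=; rewrite addnS doubleS.
  exact: chain_series_parallel.
- by rewrite /instance_size /= card_ord; lia.
- by rewrite split_instance_size // leq_addl.
- exact: non_dominated_split.
Qed.
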